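(* For all integers $c>0$ and $1\le i\le c$, the labelled $i$-grid $T^{c,i}$ possesses vertical symmetry and slide symmetry.
   Context: **Labelled grids.** For $n\ge 1$, an $n$-grid is the triangular graph made of $n$ rows of upright triangles: row $r$ ($1\le r\le n$, counted from the top) contains the upright triangles $T_{r,d}$, $1\le d\le r$, counted from the left. The edges of the graph are exactly the left, right and base edges of the upright triangles, and each edge belongs to exactly one upright triangle. A labelled $n$-grid $T$ is an assignment of positive real labels (resistances) $T_{L,r,d},T_{R,r,d},T_{B,r,d}$ to the left, right and base edges of each $T_{r,d}$, $1\le d\le r\le n$. **Symmetries.** A labelled $n$-grid $T$ possesses *vertical symmetry* if $T_{L,r,d}=T_{R,r,r+1-d}$ and $T_{B,r,d}=T_{B,r,r+1-d}$ for all $1\le d\le r\le n$. It possesses *slide symmetry* if $T_{L,r,d}=T_{L,n+d-r,d}$ and $T_{R,r,d}=T_{B,n+d-r,d}$ for all $1\le d\le r\le n$. **Edge-ratio functions.** $$r_{R,L}(r,d)=\frac{2(r-d)+1}{2d-1},\qquad r_{B,L}(n,r,d)=\frac{2(n-r)+1}{2d-1},$$ $$x(n,r)=\frac{r-1}{2r-1}\cdot\frac{2(n-r)+3}{(n-r)+1},\qquad y(r,d)=\frac{d-1}{2d-3}\cdot\frac{2(r-d)+3}{(r-d)+1}.$$ **Initial non-one grid.** $T^{c}$ is the labelled $c$-grid determined by $T_{L,1,1}=1$ and $T_{L,r,1}=x(c,r)\,T_{L,r-1,1}$ for $2\le r\le c$; $T_{L,r,d}=y(r,d)\,T_{L,r,d-1}$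 for $2\le d\le r\le c$; $T_{R,r,d}=r_{R,L}(r,d)\,T_{L,r,d}$ and $T_{B,r,d}=r_{B,L}(c,r,d)\,T_{L,r,d}$ for $1\le d\le r\le c$. **Row reduction.** Let $\Delta(u,v,w)=\frac{uv}{u+v+w}$ and $Y(u,v,w)=\frac{uv+vw+wu}{u}$. Given a labelled $n$-grid $T$ (the parent), $n\ge2$, apply the $\Delta$–Y transformation to each upright triangle, giving legs $$Y_{12,r,d}=\Delta(T_{L,r,d},T_{R,r,d},T_{B,r,d}),\quad Y_{4,r,d}=\Delta(T_{R,r,d},T_{B,r,d},T_{L,r,d}),\quad Y_{8,r,d}=\Delta(T_{B,r,d},T_{L,r,d},T_{R,r,d})$$ (from the center of the triangle to its top, lower right, lower left vertex respectively); discard the three corner tails $Y_{12,1,1},Y_{8,n,1},Y_{4,n,n}$; combine consecutive boundary legs in series; and apply the Y–$\Delta$ transformation to the remaining stars. The result is the row-reduced (child) labelled $(n-1)$-grid $T'$ with, explicitly: - $T'_{L,r,1}=Y_{8,r,1}+Y_{12,r+1,1}$ for $1\le r\le n-1$; - $T'_{R,r,r}=Y_{4,r,r}+Y_{12,r+1,r+1}$ for $1\le r\le n-1$; - $T'_{B,n-1,d}=Y_{4,n,d}+Y_{8,n,d+1}$ for $1\le d\le n-1$; - $T'_{L,r,d}=Y(Y_{4,r,d-1},Y_{8,r,d},Y_{12,r+1,d})$ for $2\le d\le r\le n-1$; - $T'_{R,r,d}=Y(Y_{8,r,d+1},Y_{4,r,d},Y_{12,r+1,d+1})$ for $1\le d\le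 r-1$, $r\le n-1$; - $T'_{B,r,d}=Y(Y_{12,r+2,d+1},Y_{4,r+1,d},Y_{8,r+1,d+1})$ for $1\le d\le r\le n-2$. For $1\le i\le c$, $T^{c,i}$ is the labelled $i$-grid obtained from $T^c$ by $c-i$ consecutive row reductions (so $T^{c,c}=T^c$). *)

(* Defs.v *)
From mathcomp Require Import all_boot all_order all_algebra.
From mathcomp Require Import zify ring lra.
Set Implicit Arguments.
Unset Strict Implicit.
Unset Printing Implicit Defensive.
Import Order.TTheory GRing.Theory Num.Theory.
Local Open Scope ring_scope.

(* Rows and positions are numbered from 1. *)
Definition in_grid (n r d : nat) : bool := [&& 0 < d, d <= r & r <= n]%N.

(* The label functions are total; their values at positions outside the grid
   are irrelevant: no definition below depends on them at in-grid positions. *)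
Record grid (R : realFieldType) (n : nat) := Grid {
  lblL : nat -> nat -> R;
  lblR : nat -> nat -> R;
  lblB : nat -> nat -> R;
  lbl_gt0 : forall r d, in_grid n r d ->
    [/\ 0 < lblL r d, 0 < lblR r d & 0 < lblB r d] }.

Definition vertical_symmetry (R : realFieldType) (n : nat) (T : grid R n) : Prop :=
  forall r d : nat, in_grid n r d ->
    lblL T r d = lblR T r (r + 1 - d)%N /\ lblB T r d = lblB T r (r + 1 - d)%N.

Definition slide_symmetry (R : realFieldType) (n : nat) (T : grid R n) : Prop :=
  forall r d : nat, in_grid n r d ->
    lblL T r d = lblL T (n + d - r)%N d /\ lblR T r d = lblB T (n + d - r)%N d.

Section InitialGrid.
Variable R : realFieldType.

(* All subtractions in the edge ratios are taken in R, not truncated in nat. *)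
Definition ratioRL (r d : nat) : R := (2 * (r%:R - d%:R) + 1) / (2 * d%:R - 1).

Definition ratioBL (n r d : nat) : R := (2 * (n%:R - r%:R) + 1) / (2 * d%:R - 1).

Definition ratio_x (n r : nat) : R :=
  (r%:R - 1) / (2 * r%:R - 1) *
  ((2 * (n%:R - r%:R) + 3) / ((n%:R - r%:R) + 1)).

Definition ratio_y (r d : nat) : R :=
  (d%:R - 1) / (2 * d%:R - 3) *
  ((2 * (r%:R - d%:R) + 3) / ((r%:R - d%:R) + 1)).

Fixpoint initialL1 (c r : nat) : R :=
  match r with
  | (_.+1 as s).+1 => ratio_x c r * initialL1 c s
  | _ => 1
  end.

Fixpoint initialL (c r d : nat) : R :=
  match d with
  | (_.+1 as e).+1 => ratio_y r d * initialL c r e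
  | _ => initialL1 c r
  end.

Definition initialR (c r d : nat) : R := ratioRL r d * initialL c r d.

Definition initialB (c r d : nat) : R := ratioBL c r d * initialL c r d.

Lemma ratioRL_gt0 r d : (0 < d <= r)%N -> 0 < ratioRL r d.
Proof.
case/andP=> d0 dr.
have d1 : 1 <= d%:R :> R by rewrite ler1n.
have le_dr : d%:R <= r%:R :> R by rewrite ler_nat.
by apply: divr_gt0; lra.
Qed.

Lemma ratioBL_gt0 n r d : (0 < d)%N -> (r <= n)%N -> 0 < ratioBL n r d.
Proof.
move=> d0 rn.
have d1 : 1 <= d%:R :> R by rewrite ler1n.
have le_rn : r%:R <= n%:R :> R by rewrite ler_nat.
by apply: divr_gt0; lra.
Qed.

Lemma ratio_x_gt0 n r : (1 < r <= n)%N -> 0 < ratio_x n r.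
Proof.
case/andP=> r1 rn.
have r2 : 2 <= r%:R :> R by rewrite (ler_nat R 2).
have le_rn : r%:R <= n%:R :> R by rewrite ler_nat.
by apply: mulr_gt0; apply: divr_gt0; lra.
Qed.

Lemma ratio_y_gt0 r d : (1 < d <= r)%N -> 0 < ratio_y r d.
Proof.
case/andP=> d1 dr.
have d2 : 2 <= d%:R :> R by rewrite (ler_nat R 2).
have le_dr : d%:R <= r%:R :> R by rewrite ler_nat.
by apply: mulr_gt0; apply: divr_gt0; lra.
Qed.

Lemma initialL1_gt0 c r : (r <= c)%N -> 0 < initialL1 c r.
Proof.
elim: r => [|[|r] IHr] // rc.
have IH := IHr (ltnW rc).
change (0 < ratio_x c r.+2 * initialL1 c r.+1).
by apply: mulr_gt0 => //; apply: ratio_x_gt0.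
Qed.

Lemma initialL_gt0 c r d : (d <= r)%N -> (r <= c)%N -> 0 < initialL c r d.
Proof.
move=> dr rc; elim: d dr => [|[|d] IHd] dr; try exact: initialL1_gt0.
have IH := IHd (ltnW dr).
change (0 < ratio_y r d.+2 * initialL c r d.+1).
by apply: mulr_gt0 => //; apply: ratio_y_gt0.
Qed.

Lemma initial_gt0 c r d : in_grid c r d ->
  [/\ 0 < initialL c r d, 0 < initialR c r d & 0 < initialB c r d].
Proof.
case/and3P=> d0 dr rc; have L0 := initialL_gt0 dr rc.
split=> //; apply: mulr_gt0 => //.
  by apply: ratioRL_gt0; rewrite d0.
exact: ratioBL_gt0.
Qed.

Definition initial_grid (c : nat) : grid R c := Grid (@initial_gt0 c).

End InitialGrid.

Section RowReduction.
Variable R : realFieldType.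

Definition DeltaY (u v w : R) : R := u * v / (u + v + w).

Definition YDelta (u v w : R) : R := (u * v + v * w + w * u) / u.

Lemma DeltaY_gt0 u v w : 0 < u -> 0 < v -> 0 < w -> 0 < DeltaY u v w.
Proof. by move=> u0 v0 w0; rewrite divr_gt0 ?mulr_gt0 ?addr_gt0. Qed.

Lemma YDelta_gt0 u v w : 0 < u -> 0 < v -> 0 < w -> 0 < YDelta u v w.
Proof. by move=> u0 v0 w0; rewrite divr_gt0 ?addr_gt0 ?mulr_gt0. Qed.

Variables (n : nat) (T : grid R n.+1).

(* The legs are named after the clock positions of their outer endpoints. *)
Definition Y12 (r d : nat) : R := DeltaY (lblL T r d) (lblR T r d) (lblB T r d).
Definition Y4 (r d : nat) : R := DeltaY (lblR T r d) (lblB T r d) (lblL T r d).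
Definition Y8 (r d : nat) : R := DeltaY (lblB T r d) (lblL T r d) (lblR T r d).

Definition childL (r d : nat) : R :=
  if d == 1%N then Y8 r 1 + Y12 r.+1 1
  else YDelta (Y4 r d.-1) (Y8 r d) (Y12 r.+1 d).

Definition childR (r d : nat) : R :=
  if d == r then Y4 r r + Y12 r.+1 r.+1
  else YDelta (Y8 r d.+1) (Y4 r d) (Y12 r.+1 d.+1).

(* The parent has n.+1 rows, so n is the bottom row of the child. *)
Definition childB (r d : nat) : R :=
  if r == n then Y4 n.+1 d + Y8 n.+1 d.+1
  else YDelta (Y12 r.+2 d.+1) (Y4 r.+1 d) (Y8 r.+1 d.+1).

Lemma legs_gt0 r d : in_grid n.+1 r d -> [/\ 0 < Y12 r d, 0 < Y4 r d & 0 < Y8 r d].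
Proof. by case/(lbl_gt0 T) => *; split; apply: DeltaY_gt0. Qed.

Lemma child_gt0 r d : in_grid n r d ->
  [/\ 0 < childL r d, 0 < childR r d & 0 < childB r d].
Proof.
case/and3P=> d0 dr rn; rewrite /childL /childR /childB.
have Y12_gt0 s e : in_grid n.+1 s e -> 0 < Y12 s e by case/legs_gt0.
have Y4_gt0 s e : in_grid n.+1 s e -> 0 < Y4 s e by case/legs_gt0.
have Y8_gt0 s e : in_grid n.+1 s e -> 0 < Y8 s e by case/legs_gt0.
split; case: eqP => ne; (apply: addr_gt0 || apply: YDelta_gt0);
  (apply: Y12_gt0 || apply: Y4_gt0 || apply: Y8_gt0);
  apply/and3P; split; lia.
Qed.

Definition row_reduction : grid R n := Grid child_gt0.

End RowReduction.

Fixpoint row_reductions (R : realFieldType) (k i : nat) :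
    grid R (k + i) -> grid R i :=
  match k with
  | 0 => fun T => T
  | j.+1 => fun T : grid R (j + i).+1 => row_reductions (row_reduction T)
  end.

(* Only meant for i <= c, where (c - i) + i = c; writing the size of the initial
   grid in this form makes c - i row reductions land in grid R i without a cast. *)
Definition nonone_grid (R : realFieldType) (c i : nat) : grid R i :=
  row_reductions (initial_grid R ((c - i) + i)).

(* Main.v *)
Require Import Defs.
From mathcomp Require Import all_boot all_order all_algebra.
From mathcomp Require Import zify ring lra.
Set Implicit Arguments.
Unset Strict Implicit.
Unset Printing Implicit Defensive.

(** In the coordinates a = d - 1, b = r - d, e = n - r, so that
    a + b + e = n - 1, vertical symmetry is the reflection exchanging a and b
    (and L and R), and slide symmetry the one exchanging b and e (and R and B).
    Row reduction commutes with both reflections of the triangle, and the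
    initial grid has labels proportional to (2a+1) W, (2b+1) W, (2e+1) W with
    W = w(a) w(b) w(e) symmetric in a, b, e. *)

Import Order.TTheory GRing.Theory Num.Theory.
Local Open Scope ring_scope.

Section Initial.
Variable R : realFieldType.

(** This is k! / (2k+1)!!, chosen so that the recursions for the initial labels telescope. *)
Definition weight (k : nat) : R := \prod_(j < k) (j.+1%:R / (2 * j.+1%:R + 1)).

Lemma weightS k : weight k.+1 = weight k * (k.+1%:R / (2 * k.+1%:R + 1)).
Proof. by rewrite /weight big_ord_recr. Qed.

Lemma weight_neq0 k : weight k != 0.
Proof.
apply/prodf_neq0 => j _; rewrite mulf_neq0 ?invr_eq0 ?pnatr_eq0 //.
by rewrite -natrM -(natrD _ _ 1) pnatr_eq0.
Qed.

Lemma initialL1SS c r :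
  initialL1 R c r.+2 = ratio_x R c r.+2 * initialL1 R c r.+1.
Proof. by []. Qed.

Lemma initialLSS c r d :
  initialL R c r d.+2 = ratio_y R r d.+2 * initialL R c r d.+1.
Proof. by []. Qed.

(** Here a = 0. One step down the left side raises b and lowers e, and [ratio_x] is exactly w(b+1)
    w(e) / (w(b) w(e+1)). *)
Lemma initialL1_weight b e :
  initialL1 R (b + e).+1 b.+1 * weight (b + e) = weight b * weight e.
Proof.
elim: b e => [|b IHb] e; first by rewrite /weight big_ord0.
(* Taking the hypothesis at [e.+1] keeps the size of the grid fixed. *)
have := IHb e.+1; rewrite -addSnnS => IH.
rewrite initialL1SS -mulrA IH !weightS /ratio_x.
have b0 : 0 <= b%:R :> R by [].
have e0 : 0 <= e%:R :> R by [].
rewrite -!natr1 !natrD; field.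
by rewrite !lt0r_neq0 //; lra.
Qed.

(** One step to the right along a row raises a and lowers b. The factor 2a+1 absorbs the denominator
    2d-3 of [ratio_y], which does not fit the quotient w(a+1) / w(a) alone. *)
Lemma initialL_weight a b e :
  initialL R (a + b + e).+1 (a + b).+1 a.+1 * weight (a + b + e) =
  (2 * a%:R + 1) * (weight a * weight b * weight e).
Proof.
elim: a b => [|a IHa] b.
  by rewrite add0n [initialL _ _ _ _]/= initialL1_weight /weight big_ord0; ring.
have := IHa b.+1; rewrite -addSnnS => IH.
rewrite initialLSS -mulrA IH !weightS /ratio_y.
have a0 : 0 <= a%:R :> R by [].
have b0 : 0 <= b%:R :> R by [].
rewrite -!natr1 !natrD; field.
by rewrite !lt0r_neq0 //; lra.
Qed.

(** The ratios [ratioRL] and [ratioBL] are (2b+1)/(2a+1) and (2e+1)/(2a+1), so they only replace the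
    odd factor. *)
Lemma initial_weight c r d : in_grid c r d ->
  let W := weight d.-1 * weight (r - d) * weight (c - r) / weight c.-1 in
  [/\ initialL R c r d = (2 * d.-1%:R + 1) * W,
      initialR R c r d = (2 * (r - d)%N%:R + 1) * W
    & initialB R c r d = (2 * (c - r)%N%:R + 1) * W].
Proof.
case/and3P => d0 dr rc W.
have a0 : 0 <= d.-1%:R :> R by [].
have dE : d%:R = d.-1%:R + 1 :> R by rewrite natr1 prednK.
have LE : initialL R c r d = (2 * d.-1%:R + 1) * W.
  have := initialL_weight d.-1 (r - d) (c - r).
  have -> : (d.-1 + (r - d) + (c - r) = c.-1)%N by lia.
  have -> : ((d.-1 + (r - d)).+1 = r)%N by lia.
  have -> : c.-1.+1 = c by lia.
  rewrite prednK // => E.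
  by rewrite /W mulrA -E mulfK ?weight_neq0.
split=> //.
  rewrite /initialR LE /ratioRL natrB // dE; field.
  by rewrite lt0r_neq0 //; lra.
rewrite /initialB LE /ratioBL natrB // dE; field.
by rewrite lt0r_neq0 //; lra.
Qed.

Lemma initial_vertical c : vertical_symmetry (initial_grid R c).
Proof.
move=> r d rd; have rd' : in_grid c r (r + 1 - d) by move: rd; rewrite /in_grid; lia.
have /= [LE RE BE] := initial_weight rd; have /= [_ RE' BE'] := initial_weight rd'.
case/and3P: rd => d0 dr rc; rewrite /= LE BE RE' BE'.
have -> : (r - (r + 1 - d) = d.-1)%N by lia.
have -> : ((r + 1 - d).-1 = r - d)%N by lia.
by split; ring.
Qed.

Lemma initial_slide c : slide_symmetry (initial_grid R c).
Proof.
move=> r d rd; have rd' : in_grid c (c + d - r) d by move: rd; rewrite /in_grid; lia.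
have /= [LE RE BE] := initial_weight rd; have /= [LE' _ BE'] := initial_weight rd'.
case/and3P: rd => d0 dr rc; rewrite /= LE RE LE' BE'.
have -> : (c + d - r - d = c - r)%N by lia.
have -> : (c - (c + d - r) = r - d)%N by lia.
by split; ring.
Qed.

End Initial.

Section Reduction.
Variable R : realFieldType.

Lemma DeltaYC (u v w : R) : DeltaY u v w = DeltaY v u w.
Proof. by rewrite /DeltaY [u * v]mulrC [u + v]addrC. Qed.

Lemma YDeltaC (u v w : R) : YDelta u v w = YDelta u w v.
Proof. by rewrite /YDelta; congr (_ / _); ring. Qed.

Variables (n : nat) (T : grid R n.+1).

(** Swapping L and R while fixing B swaps the two lower legs. The mirror position is given by
    equations, so that any form of the indices can be supplied and checked by [lia]. *)
Lemma legs_vertical : vertical_symmetry T -> forall r d s e,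
  in_grid n.+1 r d -> s = r -> (d + e = r.+1)%N ->
  [/\ Y12 T r d = Y12 T s e, Y4 T r d = Y8 T s e & Y8 T r d = Y4 T s e].
Proof.
move=> vT r d _ e rd -> de.
have re : in_grid n.+1 r e by move: rd; rewrite /in_grid; lia.
have [LR BB] := vT r d rd; have [LR' _] := vT r e re.
have dE : (r + 1 - e = d)%N by lia.
have eE : (r + 1 - d = e)%N by lia.
rewrite eE in LR BB; rewrite dE in LR'.
rewrite /Y12 /Y4 /Y8 LR BB -LR'; split; exact: DeltaYC.
Qed.

(** Swapping R and B while fixing L swaps the top and lower left legs. *)
Lemma legs_slide : slide_symmetry T -> forall r d s e,
  in_grid n.+1 r d -> e = d -> (r + s = n.+1 + d)%N ->
  [/\ Y12 T r d = Y8 T s e, Y4 T r d = Y4 T s e & Y8 T r d = Y12 T s e].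
Proof.
move=> sT r d s _ rd -> rs.
have sd : in_grid n.+1 s d by move: rd; rewrite /in_grid; lia.
have [LL RB] := sT r d rd; have [_ RB'] := sT s d sd.
have rE : (n.+1 + d - s = r)%N by lia.
have sE : (n.+1 + d - r = s)%N by lia.
rewrite sE in LL RB; rewrite rE in RB'.
rewrite /Y12 /Y4 /Y8 LL RB -RB'; split; exact: DeltaYC.
Qed.

Lemma row_reduction_vertical :
  vertical_symmetry T -> vertical_symmetry (row_reduction T).
Proof.
move=> vT r d /and3P[d0 dr rn] /=; have V := legs_vertical vT.
rewrite /childL /childR /childB; split.
  case: eqP => [d1|d1]; case: eqP => [e1|e1]; try lia.
    have [|||_ _ ->] := V r 1%N r r; rewrite /in_grid; try lia.
    by have [|||-> _ _] := V r.+1 1%N r.+1 r.+1; rewrite /in_grid; try lia.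
  have [|||_ -> _] := V r d.-1 r (r + 1 - d).+1; rewrite /in_grid; try lia.
  have [|||_ _ ->] := V r d r (r + 1 - d)%N; rewrite /in_grid; try lia.
  by have [|||-> _ _] := V r.+1 d r.+1 (r + 1 - d).+1; rewrite /in_grid; try lia.
case: eqP => [rE|rn'].
  have [|||_ -> _] := V n.+1 d n.+1 (r + 1 - d).+1; rewrite /in_grid; try lia.
  have [|||_ _ ->] := V n.+1 d.+1 n.+1 (r + 1 - d)%N; rewrite /in_grid; try lia.
  by rewrite addrC.
have [|||-> _ _] := V r.+2 d.+1 r.+2 (r + 1 - d).+1; rewrite /in_grid; try lia.
have [|||_ -> _] := V r.+1 d r.+1 (r + 1 - d).+1; rewrite /in_grid; try lia.
have [|||_ _ ->] := V r.+1 d.+1 r.+1 (r + 1 - d)%N; rewrite /in_grid; try lia.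
(* A base edge is sent to a base edge, and the reflection reverses the other two legs of its
   star. *)
exact: YDeltaC.
Qed.

Lemma row_reduction_slide :
  slide_symmetry T -> slide_symmetry (row_reduction T).
Proof.
move=> sT r d /and3P[d0 dr rn] /=; have S := legs_slide sT.
rewrite /childL /childR /childB; split.
  case: eqP => [d1|d1].
    have [|||_ _ ->] := S r 1%N (n + d - r).+1 1%N; rewrite /in_grid; try lia.
    have [|||-> _ _] := S r.+1 1%N (n + d - r)%N 1%N; rewrite /in_grid; try lia.
    by rewrite addrC.
  (* The child reflects row r to n+d-r, but the parent has one more row, hence the shifts by one in
     the mirror rows. *)
  have [|||_ -> _] := S r d.-1 (n + d - r)%N d.-1; rewrite /in_grid; try lia.
  have [|||_ _ ->] := S r d (n + d - r).+1 d; rewrite /in_grid; try lia.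
  have [|||-> _ _] := S r.+1 d (n + d - r)%N d; rewrite /in_grid; try lia.
  exact: YDeltaC.
(* The right side of the child (d = r) is sent to its bottom row, so the mixed cases are
   contradictory. *)
case: eqP => [dE|dE]; case: eqP => [e1|e1]; try lia.
  have [|||_ -> _] := S r r n.+1 d; rewrite /in_grid; try lia.
  by have [|||-> _ _] := S r.+1 r.+1 n.+1 d.+1; rewrite /in_grid; try lia.
have [|||_ _ ->] := S r d.+1 (n + d - r).+2 d.+1; rewrite /in_grid; try lia.
have [|||_ -> _] := S r d (n + d - r).+1 d; rewrite /in_grid; try lia.
by have [|||-> _ _] := S r.+1 d.+1 (n + d - r).+1 d.+1; rewrite /in_grid; try lia.
Qed.

End Reduction.

Lemma row_reductions_symmetry (R : realFieldType) k i (T : grid R (k + i)) :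
  vertical_symmetry T -> slide_symmetry T ->
  vertical_symmetry (row_reductions T) /\ slide_symmetry (row_reductions T).
Proof.
elim: k T => [|k IHk] T vT sT //=; apply: IHk.
  exact: row_reduction_vertical.
exact: row_reduction_slide.
Qed.

Local Close Scope ring_scope.

Theorem theorem3 (R : realFieldType) (c i : nat) (hc : 0 < c) (hi : 1 <= i <= c) :
  vertical_symmetry (nonone_grid R c i) /\ slide_symmetry (nonone_grid R c i).
Proof.
apply: row_reductions_symmetry.
  exact: initial_vertical.
exact: initial_slide.
Qed.
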